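(* Let $p$ be a prime and let $k,n$ be nonnegative integers. (1) If $p\equiv 1 \pmod 3$, then \[A_{3}\Big(p^kn+\frac{2p^{k}-2}{3}\Big)=\frac{p^{k}-1}{p-1}A_{3}\Big(pn+\frac{2p-2}{3}\Big)-\frac{p^{k}-p}{p-1}A_{3}(n).\] (2) If $p\equiv 2 \pmod 3$, then \[A_{3}\Big(p^{2k}n+\frac{2p^{2k}-2}{3}\Big)=\frac{p^{2k}-1}{p^2-1}A_{3}\Big(p^2n+\frac{2p^2-2}{3}\Big)-\frac{p^{2k}-p^2}{p^2-1}A_{3}(n).\]
   Context: A partition $\lambda$ of a nonnegative integer is called a $3$-core if none of its hook lengths is divisible by $3$. $A_3(n)$ denotes the number of ordered pairs $(\lambda_1,\lambda_2)$ of partitions, each a $3$-core, whose sizes sum to $n$; equivalently $\sum_{n\ge0}A_3(n)q^n=\frac{(q^3;q^3)_\infty^{6}}{(q;q)_\infty^{2}}$, where $(a;q)_\infty=\prod_{k\ge0}(1-aq^k)$. *)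

(* Defs.v *)
From mathcomp Require Import all_boot all_order all_algebra.
Set Implicit Arguments. Unset Strict Implicit. Unset Printing Implicit Defensive.
Import GRing.Theory Num.Theory.
Local Open Scope ring_scope.

(* Truncation of the generating function
     (q^3;q^3)_oo^6 / (q;q)_oo^2
   = prod_{k>=1} (1 - q^(3k))^6 * (sum_{j>=0} q^(kj))^2
   that is exact up to degree n: factors with k > n, and the terms q^(kj)
   with j > n, only contribute to degrees > n. *)
Definition A3_trunc (n : nat) : {poly int} :=
  \prod_(1 <= k < n.+1)
     ((1 - 'X^(3 * k)) ^+ 6 * (\sum_(0 <= j < n.+1) 'X^(k * j)) ^+ 2).

(* A_3(n) : the coefficient of q^n in (q^3;q^3)_oo^6 / (q;q)_oo^2, i.e. the
   number of ordered pairs of 3-core partitions with sizes summing to n. *)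
Definition A3 (n : nat) : int := (A3_trunc n)`_n.

(* Main.v *)
Require Import Defs.
From mathcomp Require Import all_boot all_order all_algebra.
From mathcomp Require Import ring zify.
Set Implicit Arguments. Unset Strict Implicit. Unset Printing Implicit Defensive.
Import GRing.Theory Num.Theory.
Local Open Scope ring_scope.

(* In fact 3 A_3(n) = sigma(3n+2), and the theorem is the Hecke relation of the
   divisor sum sigma, which follows from sigma(p m) - p sigma(m) being the sum of
   the divisors of m not divisible by p.

   To evaluate A_3, take the logarithmic derivative of the product: with
   s(j) = sum_{a | j} a (1 - 3 [3 | a]) it gives
   m A_3(m) = 2 sum_{1 <= j <= m} s(j) A_3(m - j).  So it suffices that sigma
   satisfies 6 sum_j s(j) sigma(N - 3j) = (N - 2) sigma(N) for N = 2 mod 3.  This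
   is proved by Liouville's elementary method: the left-hand side is a sum over
   the positive solutions of a x + b y = N, which are permuted by the symmetries
   of the equation and, on the part a > b, by the involution
   (a, b, x, y) -> (x + y, x, b, a - b); with a suitable weight everything
   cancels except the solutions with a = b. *)

(** * Weights on the solutions of a x + b y = N and their symmetries *)

(** The condition on [x] turns [a * x] into [3 * j] with [a] dividing [j]; what remains is a summand
    of [wdiv j] times a divisor [b] of [N - 3 * j]. *)
Definition conv_weight (a b x y : nat) : int :=
  (a * b)%:R * ((x %% 3 == 0)%N%:R * (1 - 3 * (a %% 3 == 0)%N%:R)).

(* Found by solving a linear system: among the functions quadratic in a, b, x, y
   with coefficients depending on residues modulo 3, phi has the same symmetrization
   as conv_weight (D4sum_eq) and its symmetrization under (a, x) <-> (b, y) is odd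
   for the involution (a, b, x, y) -> (x + y, x, b, a - b) (psi_involution). *)
Definition phi (a b x y : nat) : int :=
  (b%:R * y%:R + b%:R * x%:R - a%:R * x%:R) *
    (((a %% 3 == 0) && (x %% 3 == b %% 3))%N%:R +
     ((y %% 3 == 0) && (a %% 3 == b %% 3))%N%:R)
  - a%:R * y%:R *
    (((a %% 3 == 0) && (x %% 3 == 0))%N%:R +
     ((b %% 3 == 0) && (y %% 3 == 0))%N%:R).

(* The dihedral group of order 8 generated by (a, x) <-> (b, y) and a <-> x acts on
   the solutions of a x + b y = N. *)
Definition D4sum (f : nat -> nat -> nat -> nat -> int) a b x y :=
  (f a b x y + f x b a y + (f a y x b + f x y a b))
 + (f b a y x + f y a b x + (f b x y a + f y x b a)).

Lemma mod3P n : [\/ n %% 3 = 0, n %% 3 = 1 | n %% 3 = 2]%N.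
Proof.
have := ltn_pmod n (isT : 0 < 3)%N.
by case: (n %% 3)%N => [|[|[|]]] // _; [constructor 1|constructor 2|constructor 3].
Qed.

Lemma D4sum_eq a b x y : ((a * x + b * y) %% 3 = 2)%N ->
  D4sum conv_weight a b x y = D4sum phi a b x y.
Proof.
(* The hypothesis and the indicators depend only on the four residues, so each residue class with N
   = 2 mod 3 leaves a polynomial identity. *)
rewrite -modnDm -(modnMm a) -(modnMm b) /D4sum /conv_weight /phi.
case: (mod3P a) => ->; case: (mod3P b) => ->; case: (mod3P x) => ->;
  case: (mod3P y) => -> //= _; ring.
Qed.

(** The swap [(a, x) <-> (b, y)] folds the part [a < b] onto [b < a]; this is the total weight then
    carried by a solution with [b < a]. *)
Definition psi a b x y := phi a b x y + phi b a y x.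

(** Writing [a] as [b + c] replaces the truncated difference [a - b] by [c], so the same check on
    residues applies. *)
Lemma psi_involution b c x y : (((b + c) * x + b * y) %% 3 = 2)%N ->
  psi (b + c) b x y + psi (x + y) x b c = 0.
Proof.
rewrite -modnDm -(modnMm (b + c)) -(modnMm b) /psi /phi -(modnDm b) -(modnDm x).
case: (mod3P c) => ->; case: (mod3P b) => ->; case: (mod3P x) => ->;
  case: (mod3P y) => -> //= _; ring.
Qed.

(** * Sums over the solutions and their reduction to a = b *)

Lemma big_involution (T : eqType) (r : seq T) (f : T -> T) (F : T -> int) :
  uniq r -> {in r, forall q, f q \in r} -> {in r, cancel f f} ->
  \sum_(q <- r) F q = \sum_(q <- r) F (f q).
Proof.
move=> r_uniq fr fK; rewrite -(big_map f xpredT F); apply: perm_big.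
apply: uniq_perm => //; first by rewrite map_inj_in_uniq //; apply: can_in_inj fK.
move=> q; apply/idP/mapP => [qr | [p pr ->]]; last exact: fr.
by exists (f q); rewrite ?fK ?fr.
Qed.

(** The ranges lose nothing: in a positive solution no coordinate exceeds [N]. *)
Definition sols (N : nat) : seq (nat * nat * nat * nat) :=
  let r := iota 1 N in
  [seq q <- [seq (u, y) | u <- [seq (u, x) | u <- [seq (a, b) | a <- r, b <- r],
                                             x <- r], y <- r]
   | let: (a, b, x, y) := q in a * x + b * y == N]%N.

Lemma sols_uniq N : uniq (sols N).
Proof.
have pairs_uniq (S T : eqType) (s : seq S) (t : seq T) :
    uniq s -> uniq t -> uniq [seq (u, v) | u <- s, v <- t].
  by move=> ? ?; apply: allpairs_uniq => // -[? ?] [].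
by apply: filter_uniq; rewrite !pairs_uniq ?iota_uniq.
Qed.

Lemma mem_sols N a b x y :
  ((a, b, x, y) \in sols N) =
  [&& 0 < a, 0 < b, 0 < x, 0 < y & a * x + b * y == N]%N.
Proof.
rewrite mem_filter; apply/andP/idP => [[eN]|].
  case/allpairsP => -[u y'] /= [/allpairsP[[v x'] /= [/allpairsP[[a' b'] /= [ar br ->]] xr ->]] yr].
  case=> ? ? ? ?; subst; move: ar br xr yr; rewrite !mem_iota.
  by move=> /andP[-> _] /andP[-> _] /andP[-> _] /andP[-> _].
case/and5P => a0 b0 x0 y0 eN; split=> //.
have [? ?] : (a * x <= N /\ b * y <= N)%N by split; rewrite -(eqP eN) ?leq_addr ?leq_addl.
have mr t : (0 < t -> t <= N -> t \in iota 1 N)%N by rewrite mem_iota => -> ?.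
rewrite !allpairs_f ?mr //; nia.
Qed.

Definition on4 (F : nat -> nat -> nat -> nat -> int) (q : nat * nat * nat * nat) :=
  let: (a, b, x, y) := q in F a b x y.

Lemma sum_sols_swap N F :
  \sum_(q <- sols N) on4 F q = \sum_(q <- sols N) on4 (fun a b x y => F b a y x) q.
Proof.
rewrite (@big_involution _ _ (fun q => let: (a, b, x, y) := q in (b, a, y, x))).
- by apply: eq_bigr => [[[[]]]].
- exact: sols_uniq.
- by case=> [[[a b] x] y]; rewrite !mem_sols addnC => /and5P[-> -> -> ->].
- by case=> [[[]]].
Qed.

Lemma sum_sols_transpose N F :
  \sum_(q <- sols N) on4 F q = \sum_(q <- sols N) on4 (fun a b x y => F x b a y) q.
Proof.
rewrite (@big_involution _ _ (fun q => let: (a, b, x, y) := q in (x, b, a, y))).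
- by apply: eq_bigr => [[[[]]]].
- exact: sols_uniq.
- by case=> [[[a b] x] y]; rewrite !mem_sols (mulnC a) => /and5P[-> -> -> ->].
- by case=> [[[]]].
Qed.

Lemma sum_D4sum N F :
  \sum_(q <- sols N) on4 (D4sum F) q = 8 * \sum_(q <- sols N) on4 F q.
Proof.
pose S G := \sum_(q <- sols N) on4 G q.
have splitD G K : S (fun a b x y => G a b x y + K a b x y) = S G + S K.
  by rewrite /S -big_split; apply: eq_bigr => [[[[]]]].
have sw G : S (fun a b x y => G b a y x) = S G by rewrite /S [RHS]sum_sols_swap.
have tr G : S (fun a b x y => G x b a y) = S G by rewrite /S [RHS]sum_sols_transpose.
(* The exchange [b <-> y] is [a <-> x] conjugated by the swap. *)
have ts G : S (fun a b x y => G a y x b) = S G.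
  by rewrite -(sw G) -[RHS]tr -[RHS]sw.
rewrite -/(S _) -/(S F) /D4sum !splitD.
rewrite (tr F) (ts F) (ts (fun a b x y => F x b a y)) (tr F) (sw F).
rewrite (ts (fun a b x y => F b a y x)) (tr (fun a b x y => F b a y x)).
by rewrite (tr (fun a b x y => F y a b x)) (ts (fun a b x y => F b a y x)) (sw F); ring.
Qed.

(** The involution preserves the equation, since [(x + y) * b + x * (a - b) = a * x + b * y], and
    the condition [b < a], since [x < x + y]. *)
Lemma sum_sols_gt N F :
  \sum_(q <- sols N | (q.1.1.2 < q.1.1.1)%N) on4 F q =
  \sum_(q <- sols N | (q.1.1.2 < q.1.1.1)%N)
     on4 (fun a b x y => F (x + y) x b (a - b))%N q.
Proof.
rewrite -[LHS]big_filter -[RHS]big_filter.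
rewrite (@big_involution _ _ (fun q => let: (a, b, x, y) := q in (x + y, x, b, a - b)%N)).
- by apply: eq_bigr => [[[[]]]].
- exact/filter_uniq/sols_uniq.
- case=> [[[a b] x] y]; rewrite mem_filter mem_sols /= => /andP[ba].
  case/and5P=> a0 b0 x0 y0 /eqP eN; rewrite mem_filter mem_sols /=.
  apply/andP; split; first by lia.
  by apply/and5P; split; lia.
- case=> [[[a b] x] y]; rewrite mem_filter mem_sols /= => /andP[ba _].
  by congr (_, _, _, _); lia.
Qed.

Lemma sum_sols_phi N : (N %% 3 = 2)%N ->
  \sum_(q <- sols N) on4 conv_weight q =
  \sum_(q <- sols N | q.1.1.1 == q.1.1.2) on4 phi q.
Proof.
move=> N2.
have -> : \sum_(q <- sols N) on4 conv_weight q = \sum_(q <- sols N) on4 phi q.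
  (* The two symmetrizations agree on solutions, and each sums to 8 times the original sum. *)
  suff: 8 * \sum_(q <- sols N) on4 conv_weight q = 8 * \sum_(q <- sols N) on4 phi q.
    by apply: mulfI.
  rewrite -!sum_D4sum; apply: eq_big_seq => -[[[a b] x] y].
  by rewrite mem_sols => /and5P[_ _ _ _ /eqP eN]; rewrite /on4 D4sum_eq ?eN.
rewrite (bigID (fun q => q.1.1.1 == q.1.1.2)) /=.
rewrite -[RHS]addr0; congr (_ + _).
rewrite (bigID (fun q => q.1.1.2 < q.1.1.1)%N) /=.
(* The swap carries the part [a < b] to [b < a], where it completes [phi] to [psi]. *)
have -> : \sum_(q <- sols N | (q.1.1.1 != q.1.1.2) && ~~ (q.1.1.2 < q.1.1.1)%N) on4 phi q
   = \sum_(q <- sols N | (q.1.1.2 < q.1.1.1)%N) on4 (fun a b x y => phi b a y x) q.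
  transitivity (\sum_(q <- sols N) on4 (fun a b x y => if (a < b)%N then phi a b x y else 0) q).
    rewrite big_mkcond; apply: eq_bigr => -[[[a b] x] y] _ /=.
    by case: ltngtP.
  rewrite sum_sols_swap [RHS]big_mkcond; apply: eq_bigr => -[[[a b] x] y] _ //.
have -> : \sum_(q <- sols N | (q.1.1.1 != q.1.1.2) && (q.1.1.2 < q.1.1.1)%N) on4 phi q
   = \sum_(q <- sols N | (q.1.1.2 < q.1.1.1)%N) on4 phi q.
  by apply: eq_bigl => -[[[a b] x] y] /=; case: ltngtP.
rewrite -big_split /=.
transitivity (\sum_(q <- sols N | (q.1.1.2 < q.1.1.1)%N) on4 psi q).
  by apply: eq_bigr => [[[[]]]].
(* Adding to [S] its image under the involution makes every term vanish by [psi_involution]. *)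
set S := \sum_(q <- _ | _) _.
suff: 2 * S = 0 by move/eqP; rewrite mulf_eq0 => /orP[|/eqP].
rewrite mulr_natl mulr2n {2}/S sum_sols_gt -big_split /=.
rewrite big_seq_cond big1 // => -[[[a b] x] y] /andP[].
rewrite mem_sols => /and5P[_ _ _ _ /eqP eN] /= ba.
by move: eN; rewrite -{1 2}(subnKC (ltnW ba)) => eN; rewrite psi_involution // eN.
Qed.

Lemma sum_sols_nested N F :
  \sum_(q <- sols N) on4 F q =
  \sum_(a <- iota 1 N) \sum_(b <- iota 1 N) \sum_(x <- iota 1 N)
    \sum_(y <- iota 1 N | (a * x + b * y == N)%N) F a b x y.
Proof.
rewrite big_filter big_mkcond !big_allpairs.
do 3![apply: eq_bigr => ? _]; by rewrite [RHS]big_mkcond.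
Qed.

(** * Divisor sums and the evaluation of the diagonal *)

Definition sigma (n : nat) : int := \sum_(d <- divisors n) d%:R.

Lemma sum_dvd_iota (N M : nat) (F : nat -> int) : (0 < M <= N)%N ->
  \sum_(d <- iota 1 N | (d %| M)%N) F d = \sum_(d <- divisors M) F d.
Proof.
case/andP=> M0 MN; rewrite -big_filter; apply: perm_big; apply: uniq_perm.
- by rewrite filter_uniq ?iota_uniq.
- exact: divisors_uniq.
move=> d; rewrite mem_filter mem_iota -dvdn_divisors //.
case dM: (d %| M)%N => //=; have := dvdn_gt0 M0 dM; have := dvdn_leq M0 dM; lia.
Qed.

Lemma sum_divisors_compl M (F : nat -> int) : (0 < M)%N ->
  \sum_(d <- divisors M) F d = \sum_(d <- divisors M) F (M %/ d)%N.
Proof.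
move=> M0; apply: big_involution; first exact: divisors_uniq.
- move=> d; rewrite -!dvdn_divisors // => dM.
  by apply/dvdnP; exists d; rewrite mulnC divnK.
- by move=> d; rewrite -dvdn_divisors // => dM; rewrite divnA // mulKn.
Qed.

(** On the diagonal [x + y = e] with [x] positive, so [y] stops at [e.-1]. *)
Definition sum_mult3 (e : nat) : int := \sum_(y <- iota 1 e.-1 | (y %% 3 == 0)%N) y%:R.

(** As 3 does not divide [e], the multiples of 3 below [e] are 3, 6, ..., 3k with [k = e %/ 3];
    doubling avoids a division. *)
Lemma sum_mult3E e : (e %% 3 != 0)%N ->
  sum_mult3 e * 2 = (e %/ 3)%:R * ((e %/ 3)%:R + 1) * 3.
Proof.
rewrite /sum_mult3 => e3; set k := (e %/ 3)%N.
have -> : \sum_(y <- iota 1 e.-1 | (y %% 3 == 0)%N) (y%:R : int)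
   = \sum_(y <- iota 1 k) (3 * y)%:R.
  rewrite -[LHS]big_filter -(big_map (muln 3) xpredT (fun y => y%:R)).
  apply: perm_big; apply: uniq_perm.
  - by rewrite filter_uniq ?iota_uniq.
  - by rewrite map_inj_uniq ?iota_uniq // => x y /eqP; rewrite eqn_mul2l => /eqP.
  move=> y; rewrite mem_filter mem_iota; apply/idP/mapP => [y3|[x]].
    by exists (y %/ 3)%N; rewrite ?mem_iota; lia.
  by rewrite mem_iota => xk ->; lia.
elim: k => [|k IH]; first by rewrite big_nil; ring.
have -> : iota 1 k.+1 = rcons (iota 1 k) k.+1 by rewrite -(addn1 k) iotaD cats1 addnC.
by rewrite big_rcons /= mulrDl IH natrM -(natr1 k); ring.
Qed.

Lemma sum_sols_diag N : (N %% 3 = 2)%N ->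
  \sum_(q <- sols N | q.1.1.1 == q.1.1.2) on4 phi q =
  \sum_(d <- divisors N) d%:R * sum_mult3 (N %/ d).
Proof.
move=> N2; have N0 : (0 < N)%N by case: N N2.
(* For [a = b], [N = a * (x + y)] is prime to 3, hence so is [a], and [phi] collapses to [a * y] on
   multiples of 3. *)
transitivity (\sum_(q <- sols N) on4 (fun a b x y =>
  if (a == b) && (y %% 3 == 0)%N then a%:R * y%:R else 0) q).
  rewrite big_mkcond /=; apply: eq_big_seq => -[[[a b] x] y].
  rewrite mem_sols => /and5P[_ _ _ _ /eqP eN] /=.
  case: eqP => //= eab; move: N2; rewrite -eN -eab -mulnDr -modnMm -modnDm /phi eqxx.
  case: (mod3P a) => ->; case: (mod3P x) => ->; case: (mod3P y) => -> //= _; ring.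
rewrite sum_sols_nested -(@sum_dvd_iota N) ?N0 ?leqnn // [RHS]big_mkcond.
apply: eq_big_seq => a; rewrite mem_iota => /andP[a0 aN].
transitivity (\sum_(x <- iota 1 N)
    \sum_(y <- iota 1 N | ((a * (x + y) == N) && (y %% 3 == 0))%N) (a%:R * y%:R : int)).
  rewrite (bigD1_seq a) ?iota_uniq ?mem_iota ?a0 //= [X in _ + X]big1 ?addr0.
    by apply: eq_bigr => x _; rewrite eqxx -big_mkcondr; apply: eq_bigl => y; rewrite mulnDr.
  move=> b ba; rewrite big1 // => x _; rewrite big1 // => y _.
  by rewrite eq_sym (negbTE ba).
case: ifP => [/dvdnP[e eN]|aN']; last first.
  rewrite big1 // => x _; rewrite big1 // => y /andP[/eqP eN].
  by rewrite -eN dvdn_mulr in aN'.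
rewrite (exchange_big_dep (fun y => (y %% 3 == 0)%N)) /=; last by move=> x y _ /andP[].
rewrite eN mulnK // /sum_mult3 big_distrr /=.
transitivity (\sum_(y <- iota 1 (e * a) | ((y %% 3 == 0) && (y < e))%N) (a%:R * y%:R : int)).
  rewrite [RHS]big_mkcondr big_seq_cond [RHS]big_seq_cond.
  apply: eq_bigr => y /andP[]; rewrite mem_iota => /andP[y0 yN] y3.
  (* For fixed [y] the only candidate is [x = e - y], positive exactly when [y < e]. *)
  rewrite y3 big_seq_cond (eq_bigl (fun x => (x == e - y) && (y < e))%N); last first.
    move=> x; rewrite mem_iota andbT (mulnC e) eqn_pmul2l //; nia.
  case: ifP => ye; last by rewrite big1 // => x; rewrite andbF.
  under eq_bigl do rewrite andbT.
  by rewrite -big_filter filter_pred1_uniq ?big_seq1 ?iota_uniq ?mem_iota //; nia.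
rewrite -[LHS]big_filter -[RHS]big_filter; apply: perm_big; apply: uniq_perm.
- by rewrite filter_uniq ?iota_uniq.
- by rewrite filter_uniq ?iota_uniq.
by move=> y; rewrite !mem_filter !mem_iota; nia.
Qed.

(** Pairing [d] with [e = N %/ d] makes the identity hold term by term. One of them is 1 and the
    other 2 mod 3, and [6 * sum_mult3 c] is (c - 1)(c + 2) or (c - 2)(c + 1) accordingly; the
    products d e cancel and (d e - 2)(d + e) remains. *)
Lemma sum_divisors_sum_mult3 N : (N %% 3 = 2)%N ->
  6 * \sum_(d <- divisors N) d%:R * sum_mult3 (N %/ d) = (N%:R - 2) * sigma N.
Proof.
move=> N2; have N0 : (0 < N)%N by case: N N2.
set A := \sum_(_ <- _) _.
have A2 : A = \sum_(d <- divisors N) (N %/ d)%:R * sum_mult3 d.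
  rewrite /A sum_divisors_compl //; apply: eq_big_seq => d.
  by rewrite -dvdn_divisors // => dN; rewrite divnA // mulKn.
suff : 2 * (6 * A) = 2 * ((N%:R - 2) * sigma N) by apply: mulfI.
have -> : 2 * (6 * A) = 12 * A by ring.
have -> : 2 * ((N%:R - 2) * sigma N) = (N%:R - 2) * (sigma N + \sum_(d <- divisors N) (N %/ d)%:R).
  by rewrite /sigma -[in RHS]sum_divisors_compl //; ring.
rewrite [12 * A](_ : _ = 6 * (A + A)); last by ring.
rewrite {2}A2 /sigma -!big_split !mulr_sumr; apply: eq_big_seq => d.
rewrite -dvdn_divisors // => /dvdnP[e eN].
have d0 : (0 < d)%N by case: d eN N0 => //; rewrite muln0 => ->.
rewrite eN mulnK //= natrM; move: N2; rewrite eN -modnMm.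
have tE c : (c %% 3 != 0)%N -> 2 * sum_mult3 c = (c %/ 3)%:R * ((c %/ 3)%:R + 1) * 3.
  by move=> ?; rewrite -sum_mult3E // mulrC.
have cE c : c%:R = (c %/ 3)%:R * 3 + (c %% 3)%:R :> int by rewrite -natrM -natrD -divn_eq.
move=> de2; have [d3 e3] : (d %% 3 != 0)%N /\ (e %% 3 != 0)%N.
  by split; apply: contra_eqN de2 => /eqP ->; rewrite ?muln0.
transitivity (3 * (d%:R * (2 * sum_mult3 e) + e%:R * (2 * sum_mult3 d))); first by ring.
rewrite !tE // (cE d) (cE e).
move: de2 d3 e3; case: (mod3P d) => ->; case: (mod3P e) => -> //= _ _ _; ring.
Qed.

(** * The convolution identity for sigma *)

(** This is s(j), equal to sigma(j) - 9 sigma(j/3), the last term being absent when 3 does not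
    divide j. *)
Definition wdiv (j : nat) : int :=
  \sum_(a <- divisors j) a%:R * (1 - 3 * (a %% 3 == 0)%N%:R).

Lemma sum_sols_conv_weight N : (N %% 3 = 2)%N ->
  \sum_(q <- sols N) on4 conv_weight q =
  \sum_(j <- iota 1 (N %/ 3)) wdiv j * sigma (N - 3 * j).
Proof.
move=> N2; rewrite sum_sols_nested; set r := iota 1 N.
pose w a : int := a%:R * (1 - 3 * (a %% 3 == 0)%N%:R).
transitivity (\sum_(a <- r) \sum_(b <- r) \sum_(j <- iota 1 (N %/ 3))
   (if (a %| j)%N then w a else 0) * (if (b %| N - 3 * j)%N then b%:R else 0)).
  apply: eq_big_seq => a; rewrite mem_iota => /andP[a0 aN].
  apply: eq_big_seq => b; rewrite mem_iota => /andP[b0 bN].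
  (* Given [a], [b], [x], at most one [y] solves the equation; it exists when [a * x < N] and [b]
     divides [N - a * x]. *)
  transitivity (\sum_(x <- r | ((x %% 3 == 0) && (a * x < N))%N)
     w a * (if (b %| N - a * x)%N then b%:R else 0)).
    rewrite [RHS]big_mkcond; apply: eq_big_seq => x; rewrite mem_iota => /andP[x0 xN].
    have [x3|x3] /= := boolP (x %% 3 == 0)%N; last first.
      by apply: big1 => y _; rewrite /conv_weight (negbTE x3) mul0r mulr0.
    rewrite [in LHS]/conv_weight x3 mul1r.
    case: ifP => axN; last by rewrite big_seq_cond big1 // => y; rewrite mem_iota; nia.
    case: ifP => [/dvdnP[c cE]|bd]; last first.
      rewrite mulr0 big1 // => y /eqP eN.
      by rewrite -eN addKn dvdn_mulr in bd.
    rewrite big_seq_cond (eq_bigl (fun y => y == c)); last first.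
      by move=> y; rewrite mem_iota; nia.
    rewrite -big_filter filter_pred1_uniq ?big_seq1 ?iota_uniq ?mem_iota //; last by nia.
    by rewrite natrM /w; ring.
  transitivity (\sum_(j <- iota 1 (N %/ 3) | (a %| j)%N)
     w a * (if (b %| N - 3 * j)%N then b%:R else 0)); last first.
    by rewrite big_mkcond; apply: eq_bigr => j _; case: ifP => // _; rewrite mul0r.
  (* Both sides are reindexed by [t = a * x = 3 * j]; the bounds [t < N] and [j <= N %/ 3] agree
     because 3 does not divide [N]. *)
  rewrite -[LHS]big_filter -[RHS]big_filter.
  transitivity (\sum_(t <- [seq (a * x)%N | x <- [seq x <- r | ((x %% 3 == 0) && (a * x < N))%N]])
     w a * (if (b %| N - t)%N then b%:R else 0)); first by rewrite big_map.
  transitivity (\sum_(t <- [seq (3 * j)%N | j <- [seq j <- iota 1 (N %/ 3) | (a %| j)%N]])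
     w a * (if (b %| N - t)%N then b%:R else 0)); last by rewrite big_map.
  apply: perm_big; apply: uniq_perm.
  - rewrite map_inj_uniq ?filter_uniq ?iota_uniq // => u v /eqP.
    by rewrite eqn_mul2l => /predU1P[a00|/eqP//]; rewrite a00 in a0.
  - by rewrite map_inj_uniq ?filter_uniq ?iota_uniq // => u v /eqP; rewrite eqn_mul2l => /eqP.
  move=> t; apply/mapP/mapP => -[u]; rewrite mem_filter mem_iota => /andP[Pu uN] ->.
    exists (a * (u %/ 3))%N; last by nia.
    by rewrite mem_filter mem_iota dvdn_mulr //; nia.
  case/dvdnP: Pu => c uE; exists (3 * c)%N; last by nia.
  rewrite mem_filter mem_iota; nia.
under eq_bigr => a _ do rewrite exchange_big /=.
rewrite exchange_big /=; apply: eq_big_seq => j; rewrite mem_iota => /andP[j0 jN].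
under eq_bigr => a _ do rewrite -mulr_sumr.
rewrite -mulr_suml -!big_mkcond /wdiv /sigma; congr (_ * _).
  by rewrite sum_dvd_iota //; lia.
by rewrite sum_dvd_iota //; lia.
Qed.

Lemma sigma_convolution N : (N %% 3 = 2)%N ->
  6 * \sum_(j <- iota 1 (N %/ 3)) wdiv j * sigma (N - 3 * j) = (N%:R - 2) * sigma N.
Proof.
move=> N2.
by rewrite -sum_sols_conv_weight // sum_sols_phi // sum_sols_diag // sum_divisors_sum_mult3.
Qed.

(** * Truncated logarithmic derivatives *)

(* s is the logarithmic derivative q p'/p of p, up to O(q^(n+1)). *)
Definition logder (n : nat) (s p : {poly int}) :=
  exists r, 'X * p^`() = s * p + 'X^(n.+1) * r.

Lemma logder1 n : logder n 0 1.
Proof. by exists 0; rewrite -polyC1 derivC !mulr0 mul0r addr0. Qed.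

Lemma logderM n s t p q : logder n s p -> logder n t q -> logder n (s + t) (p * q).
Proof.
case=> [r rE] [u uE]; exists (r * q + p * u).
transitivity (('X * p^`()) * q + p * ('X * q^`())); first by rewrite derivM; ring.
by rewrite rE uE; ring.
Qed.

Lemma logder_prod (I : eqType) n (r : seq I) (s p : I -> {poly int}) :
  {in r, forall i, logder n (s i) (p i)} ->
  logder n (\sum_(i <- r) s i) (\prod_(i <- r) p i).
Proof.
elim: r => [|i r IH] sp; first by rewrite !big_nil; apply: logder1.
rewrite !big_cons; apply: logderM; first by apply: sp; rewrite mem_head.
by apply: IH => j jr; apply: sp; rewrite inE jr orbT.
Qed.

Lemma logderX n s p m : logder n s p -> logder n (s *+ m) (p ^+ m).
Proof.
move=> sp; elim: m => [|m IH]; first exact: logder1.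
by rewrite mulrS exprS; apply: logderM.
Qed.

(** The truncation of q^k/(1 - q^k): [1 + geom n k] is the geometric factor of [A3_trunc], and [k]
    times [geom n k] is its logarithmic derivative. *)
Definition geom (n k : nat) : {poly int} := \sum_(1 <= j < n.+1) 'X^(k * j).

Lemma geomE n k : (1 - 'X^k) * geom n k = 'X^k - 'X^(k * n.+1).
Proof.
elim: n => [|n IH]; first by rewrite /geom big_geq // mulr0 muln1 subrr.
rewrite /geom big_nat_recr //= mulrDr -/(geom n k) IH mulrBl mul1r -exprD -mulnS.
by ring.
Qed.

Lemma deriv_Xn_mulX k : 'X * ('X^k)^`() = 'X^k *+ k :> {poly int}.
Proof. by case: k => [|k]; rewrite derivXn ?mulr0n ?mulr0 // mulrnAr -exprS. Qed.

Lemma Xn_geom n k : (0 < k)%N -> exists u : {poly int}, 'X^(k * n.+1) = 'X^(n.+1) * u.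
Proof. by case: k => // k _; exists 'X^(k * n.+1); rewrite -exprD mulSn. Qed.

Lemma logder_oneBXn n k : (0 < k)%N -> logder n (- (geom n k *+ k)) (1 - 'X^k).
Proof.
move=> /(Xn_geom n)[u uE]; exists (- u *+ k).
rewrite derivB -polyC1 derivC sub0r polyC1 mulrN deriv_Xn_mulX.
rewrite mulNr mulrnAl (mulrC (geom _ _)) geomE uE; ring.
Qed.

(** Modulo ['X^(n.+1)], [1 + geom n k] is inverse to [1 - 'X^k], so differentiating their product
    [GE] gives the opposite logarithmic derivative. *)
Lemma logder_geom n k : (0 < k)%N -> logder n (geom n k *+ k) (1 + geom n k).
Proof.
move=> /(Xn_geom n)[u uE]; set G := geom n k; set d := (1 + G)^`().
have GE : (1 - 'X^k) * (1 + G) = 1 - 'X^(n.+1) * u by rewrite mulrDr geomE uE; ring.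
have dGE : (1 - 'X^k) * ('X * d) - ('X^k *+ k) * (1 + G) = - ('X^(n.+1) * u *+ (k * n.+1)).
  have := congr1 (fun p => 'X * p^`()) GE.
  rewrite -uE derivM !derivB -polyC1 derivC !sub0r -/d polyC1 => E.
  rewrite -(deriv_Xn_mulX (k * _)) -(deriv_Xn_mulX k) -[RHS]mulrN -E; ring.
pose E := 'X * d - G *+ k * (1 + G).
have EE : (1 - 'X^k) * E = 'X^(n.+1) * (u * (1 + G) *+ k - u *+ (k * n.+1)).
  transitivity ((1 - 'X^k) * ('X * d) - ((1 - 'X^k) * G) *+ k * (1 + G)).
    by rewrite /E; ring.
  rewrite geomE uE; move/eqP: dGE; rewrite subr_eq => /eqP ->.
  by ring.
(* Multiplying [EE] by [1 + G] turns its left side into [(1 - 'X^(n.+1) * u) * E]; solving for [E]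
   gives this witness. *)
exists (u * E + (1 + G) * (u * (1 + G) *+ k - u *+ (k * n.+1))).
rewrite -/G -/d; apply/eqP; rewrite addrC -subr_eq -/E; apply/eqP.
transitivity ((1 - 'X^(n.+1) * u) * E + 'X^(n.+1) * (u * E)); first by ring.
by rewrite -GE mulrAC EE; ring.
Qed.

Lemma coef_geom n k m : (0 < k)%N -> (0 < m <= n)%N -> (geom n k)`_m = (k %| m)%N%:R.
Proof.
move=> k0 mn; rewrite coef_sum; under eq_bigr do rewrite coefXn.
have [/dvdnP[j jE]|km] := boolP (k %| m)%N; last first.
  by rewrite big1 // => j _; case: eqP => // mE; rewrite mE dvdn_mulr in km.
rewrite (bigD1_seq j) ?iota_uniq ?mem_index_iota //=; last by nia.
rewrite jE mulnC eqxx big1 ?addr0 // => i ij.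
by rewrite eqn_pmul2l // eq_sym (negbTE ij).
Qed.

Lemma coef0_geom n k : (0 < k)%N -> (geom n k)`_0 = 0.
Proof.
move=> k0; rewrite coef_sum big_nat big1 // => j /andP[j0 _].
by rewrite coefXn ltn_eqF // muln_gt0 k0.
Qed.

(** * The recurrence for A_3 and its solution by sigma *)

Definition A3_logder n : {poly int} :=
  \sum_(1 <= k < n.+1) (- (geom n (3 * k) *+ (3 * k)) *+ 6 + (geom n k *+ k) *+ 2).

Lemma logder_A3 n : logder n (A3_logder n) (A3_trunc n).
Proof.
apply: logder_prod => k; rewrite mem_index_iota => /andP[k0 _].
apply: logderM; apply: logderX.
  by apply: logder_oneBXn; rewrite muln_gt0.
rewrite big_nat_recl //= muln0 expr0.
by have := logder_geom n k0; rewrite /geom big_add1.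
Qed.

Lemma coef0_A3_logder n : (A3_logder n)`_0 = 0.
Proof.
rewrite coef_sum big_nat big1 // => k /andP[k0 _].
by rewrite coefD !coefMn coefN !coefMn !coef0_geom ?muln_gt0 // !(mul0rn, oppr0, addr0).
Qed.

(** The factors contribute 2 k for each [k] dividing [m] and -18 k for each [3 * k] dividing [m];
    setting [a = 3 * k] in the latter gives the correction at divisors divisible by 3. *)
Lemma coef_A3_logder n m : (0 < m <= n)%N -> (A3_logder n)`_m = 2 * wdiv m.
Proof.
move=> mn; rewrite /A3_logder coef_sum /wdiv -(@sum_dvd_iota n) //.
have -> : \sum_(1 <= k < n.+1) (- (geom n (3 * k) *+ (3 * k)) *+ 6 + geom n k *+ k *+ 2)`_m
  = 2 * (\sum_(k <- iota 1 n) (k %| m)%N%:R * k%:R)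
    - 6 * (\sum_(k <- iota 1 n) (3 * k %| m)%N%:R * (3 * k)%:R) :> int.
  rewrite !mulr_sumr -sumrB /index_iota subn1.
  apply: eq_big_seq => k; rewrite mem_iota => /andP[k0 kn].
  rewrite coefD !coefMn coefN !coefMn !coef_geom ?muln_gt0 //.
  by ring.
have -> : \sum_(k <- iota 1 n) (3 * k %| m)%N%:R * (3 * k)%:R =
   \sum_(a <- iota 1 n | ((a %| m) && (a %% 3 == 0))%N) a%:R :> int.
  transitivity (\sum_(a <- [seq (3 * k)%N | k <- [seq k <- iota 1 n | (3 * k %| m)%N]])
      a%:R : int).
    rewrite big_map big_filter [RHS]big_mkcond; apply: eq_bigr => k _.
    by case: ifP; rewrite ?mul1r ?mul0r.
  rewrite -[RHS]big_filter; apply: perm_big; apply: uniq_perm.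
  - by rewrite map_inj_uniq ?filter_uniq ?iota_uniq // => u v /eqP; rewrite eqn_mul2l => /eqP.
  - by rewrite filter_uniq ?iota_uniq.
  move=> a; rewrite mem_filter mem_iota; apply/mapP/idP => [[k]|/andP[/andP[am a3] an]].
    rewrite mem_filter mem_iota => /andP[km kn] ->; rewrite km modnMr /=.
    have /andP[m0 _] := mn; have := dvdn_leq m0 km; lia.
  exists (a %/ 3)%N; last by lia.
  by rewrite mem_filter mem_iota mulnC divnK // am; lia.
have -> : \sum_(k <- iota 1 n) (k %| m)%N%:R * k%:R = \sum_(k <- iota 1 n | (k %| m)%N) k%:R :> int.
  rewrite [RHS]big_mkcond; apply: eq_bigr => k _.
  by case: ifP; rewrite ?mul1r ?mul0r.
rewrite big_mkcondr !mulr_sumr -sumrB; apply: eq_bigr => a _.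
by case: eqP => _ /=; ring.
Qed.

Lemma A3_trunc0 n : (A3_trunc n)`_0 = 1.
Proof.
rewrite -horner_coef0 horner_prod big_nat big1 // => k /andP[k0 _].
rewrite hornerM !horner_exp hornerD hornerN hornerC hornerXn expr0n muln_eq0 /=.
rewrite -[k == 0]negbK -lt0n k0 subr0 expr1n mul1r horner_sum big_nat_recl //=.
rewrite muln0 expr0 hornerC big1 ?addr0 ?expr1n // => j _.
by rewrite hornerXn expr0n muln_eq0 -[k == 0]negbK -lt0n k0.
Qed.

(** Compare coefficients of degree [m] in the logarithmic derivative: the error term starts beyond
    degree [n], and the term [j = 0] vanishes. *)
Lemma A3_trunc_rec n m : (m <= n)%N ->
  m%:R * (A3_trunc n)`_m = 2 * \sum_(j <- iota 1 m) wdiv j * (A3_trunc n)`_(m - j).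
Proof.
case: m => [|m] mn; first by rewrite big_nil mul0r mulr0.
have [r /(congr1 (fun p : {poly int} => p`_m.+1)) E] := logder_A3 n.
rewrite coefD coefXnM ltnS mn addr0 coefXM /= coef_deriv in E.
rewrite mulr_natl E coefM.
rewrite -(big_mkord xpredT (fun j => (A3_logder n)`_j * (A3_trunc n)`_(m.+1 - j))).
rewrite big_nat_recl // coef0_A3_logder mul0r add0r.
rewrite mulr_sumr -[iota 1 m.+1]/(index_iota 1 m.+2) big_add1 /=.
by apply: eq_big_nat => j /andP[_ jm]; rewrite coef_A3_logder ?mulrA //; lia.
Qed.

(** By [sigma_convolution] at [N = 3 * m + 2], where N - 2 = 3 m, both sides obey the same
    recurrence, starting from sigma(2) = 3. *)
Lemma A3_sigma n : 3 * A3 n = sigma (3 * n + 2).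
Proof.
rewrite /A3; set T := A3_trunc n.
(* The truncation stays fixed at [n], because the recurrence relates coefficients of one
   polynomial. *)
suff: forall m, (m <= n)%N -> 3 * T`_m = sigma (3 * m + 2) by apply.
elim/ltn_ind => -[_ _|m IH mn].
  by rewrite A3_trunc0 /sigma mulr1 muln0 add0n unlock.
have N2 : ((3 * m.+1 + 2) %% 3 = 2)%N by rewrite mulnC modnMDl.
have E := sigma_convolution N2.
rewrite (_ : (3 * m.+1 + 2) %/ 3 = m.+1)%N in E; last by rewrite mulnC divnMDl // addn0.
apply: (@mulfI _ (6 * m.+1%:R)); first by rewrite mulf_neq0 // pnatr_eq0.
transitivity (18 * (m.+1%:R * T`_m.+1)); first by ring.
transitivity (2 * (((3 * m.+1 + 2)%:R - 2) * sigma (3 * m.+1 + 2))); last first.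
  by rewrite natrD natrM; ring.
rewrite -E A3_trunc_rec //.
transitivity (12 * (3 * \sum_(j <- iota 1 m.+1) wdiv j * T`_(m.+1 - j))); first by ring.
rewrite [RHS]mulrA; congr (_ * _); rewrite mulr_sumr; apply: eq_big_seq => j.
rewrite mem_iota => /andP[j0 jm]; rewrite mulrCA IH; [|lia..].
by congr (_ * sigma _); lia.
Qed.

(** * The Hecke relation for sigma and its transfer to A_3 *)

Lemma sum_divisors_primeM p n : prime p -> (0 < n)%N ->
  \sum_(d <- divisors (p * n) | ~~ (p %| d)%N) d%:R =
  \sum_(d <- divisors n | ~~ (p %| d)%N) d%:R :> int.
Proof.
move=> p_pr n0; have pn0 : (0 < p * n)%N by rewrite muln_gt0 prime_gt0.
rewrite -[LHS]big_filter -[RHS]big_filter; apply: perm_big; apply: uniq_perm.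
- by rewrite filter_uniq ?divisors_uniq.
- by rewrite filter_uniq ?divisors_uniq.
move=> d; rewrite !mem_filter -!dvdn_divisors //; case pd: (p %| d)%N => //=.
by rewrite Gauss_dvdr // coprime_sym prime_coprime // pd.
Qed.

Lemma sigma_prime p n : prime p -> (0 < n)%N ->
  sigma (p * n) = p%:R * sigma n + \sum_(d <- divisors n | ~~ (p %| d)%N) d%:R.
Proof.
move=> p_pr n0; have p0 := prime_gt0 p_pr.
have pn0 : (0 < p * n)%N by rewrite muln_gt0 p0.
rewrite /sigma (bigID (fun d => p %| d)%N) /=; congr (_ + _).
  rewrite -big_filter mulr_sumr.
  transitivity (\sum_(d <- [seq (p * d)%N | d <- divisors n]) d%:R : int); last first.
    by rewrite big_map; apply: eq_bigr => d _; rewrite natrM.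
  apply: perm_big; apply: uniq_perm.
  - by rewrite filter_uniq ?divisors_uniq.
  - by rewrite map_inj_uniq ?divisors_uniq // => u v /eqP; rewrite eqn_pmul2l // => /eqP.
  move=> d; rewrite mem_filter -dvdn_divisors //.
  apply/andP/mapP => [[/dvdnP[e ->]]|[e]].
    by rewrite mulnC dvdn_pmul2l // => en; exists e; rewrite -?dvdn_divisors.
  by rewrite -dvdn_divisors // => en ->; rewrite dvdn_mulr // dvdn_pmul2l.
exact: sum_divisors_primeM.
Qed.

(** Successive differences of sigma along [p ^ j * n] grow by the factor [p], as the sum over
    divisors prime to [p] cancels; they telescope to a geometric series, and the factor [p - 1]
    keeps the identity in [int]. *)
Lemma sigma_primeX p k n : prime p -> (0 < n)%N ->
  (p%:R - 1) * (sigma (p ^ k * n) - sigma n) = (p%:R ^+ k - 1) * (sigma (p * n) - sigma n).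
Proof.
move=> p_pr n0; have p0 := prime_gt0 p_pr.
have step m : (0 < m)%N -> sigma (p * (p * m)) - sigma (p * m) = p%:R * (sigma (p * m) - sigma m).
  move=> m0; have pm0 : (0 < p * m)%N by rewrite muln_gt0 p0.
  rewrite (sigma_prime p_pr pm0) {2}(sigma_prime p_pr m0).
  by rewrite sum_divisors_primeM //; ring.
have diff j : sigma (p ^ j.+1 * n) - sigma (p ^ j * n) = p%:R ^+ j * (sigma (p * n) - sigma n).
  elim: j => [|j IH]; first by rewrite expn1 expn0 mul1n mul1r.
  rewrite exprS -mulrA -IH [in LHS]expnS -mulnA expnS -mulnA step //.
  by rewrite muln_gt0 expn_gt0 p0.
elim: k => [|k IH]; first by rewrite mul1n subrr mulr0 subrr mul0r.
rewrite -(subrK (sigma (p ^ k * n)) (sigma (p ^ k.+1 * n))) diff -addrA mulrDr IH exprS.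
by ring.
Qed.

(** Through [A3_sigma], the index shift of the theorem is multiplication of [3 * n + 2] by [q]; the
    division by 3 is exact as q = 1 mod 3. *)
Lemma A3_argE q n : (q %% 3 = 1)%N ->
  (3 * (q * n + (2 * q - 2) %/ 3) + 2 = q * (3 * n + 2))%N.
Proof.
move=> q1; rewrite (divn_eq q 3) q1; move: (q %/ 3)%N => t.
by rewrite (_ : 2 * (t * 3 + 1) - 2 = 2 * t * 3)%N ?mulnK //; lia.
Qed.

Lemma A3_sigmaQ n : (A3 n)%:~R = (sigma (3 * n + 2))%:~R / 3 :> rat.
Proof. by rewrite -A3_sigma rmorphM /= mulrC mulKf. Qed.

Theorem theorem2p3 (p k n : nat) :
  prime p ->
  ((p %% 3 = 1)%N ->
     (A3 (p ^ k * n + (2 * p ^ k - 2) %/ 3))%:~R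
     = ((p%:R ^+ k - 1) / (p%:R - 1)) * (A3 (p * n + (2 * p - 2) %/ 3))%:~R
       - ((p%:R ^+ k - p%:R) / (p%:R - 1)) * (A3 n)%:~R :> rat) /\
  ((p %% 3 = 2)%N ->
     (A3 (p ^ (2 * k) * n + (2 * p ^ (2 * k) - 2) %/ 3))%:~R
     = ((p%:R ^+ (2 * k) - 1) / (p%:R ^+ 2 - 1))
         * (A3 (p ^ 2 * n + (2 * p ^ 2 - 2) %/ 3))%:~R
       - ((p%:R ^+ (2 * k) - p%:R ^+ 2) / (p%:R ^+ 2 - 1)) * (A3 n)%:~R :> rat).
Proof.
move=> p_pr; have n0 : (0 < 3 * n + 2)%N by rewrite addn2.
have p1 : p%:R - 1 != 0 :> rat.
  by rewrite subr_eq0 pnatr_eq1; case: eqP p_pr => // ->.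
have sX j := congr1 (fun z : int => z%:~R : rat) (sigma_primeX j p_pr n0).
split=> p3.
  have pk3 : (p ^ k %% 3 = 1)%N by rewrite -modnXm p3 exp1n.
  rewrite !A3_sigmaQ !A3_argE //.
  have := sX k; rewrite !(rmorphM, rmorphB, rmorphXn, rmorph1, rmorph_nat) /=.
  set u := (sigma (p ^ k * _))%:~R; set v := (sigma (p * _))%:~R; set w := (sigma _)%:~R => E.
  apply: (mulfI p1); transitivity (((p%:R - 1) * (u - w) + (p%:R - 1) * w) / 3); first by ring.
  by rewrite E; field.
have pk3 : (p ^ (2 * k) %% 3 = 1)%N by rewrite expnM -modnXm -(modnXm 2) p3 exp1n.
have p23 : (p ^ 2 %% 3 = 1)%N by rewrite -modnXm p3.
rewrite !A3_sigmaQ !A3_argE //.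
have p2 : p%:R ^+ 2 - 1 != 0 :> rat.
  by rewrite -natrX subr_eq0 pnatr_eq1; case: (p) p_pr => [|[|]].
(* Both instances involve [z], the value of sigma at [p * (3 * n + 2)], an argument that is 1 mod 3
   and so gives no value of [A3]; cross-multiplying by [p ^ 2 - 1] and [p ^ (2 * k) - 1] eliminates
   it. *)
have := sX 2; have := sX (2 * k)%N.
rewrite !(rmorphM, rmorphB, rmorphXn, rmorph1, rmorph_nat) /=.
set u := (sigma (p ^ (2 * k) * _))%:~R; set v := (sigma (p ^ 2 * _))%:~R.
set w := (sigma (3 * n + 2))%:~R; set z := (sigma _)%:~R => Ek E2.
apply: (mulfI p2); apply: (mulfI p1).
transitivity ((p%:R ^+ 2 - 1) * ((p%:R - 1) * (u - w) + (p%:R - 1) * w) / 3); first by ring.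
transitivity (((p%:R ^+ (2 * k) - 1) * ((p%:R - 1) * (v - w))
               + (p%:R ^+ 2 - 1) * (p%:R - 1) * w) / 3).
  by rewrite Ek E2; ring.
by field.
Qed.
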